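(* Let $V$ be a finite-dimensional real normed space with $\dim V\ge1$, let $J=J(V)$ be the Jung constant of $V$, and let $X\subseteq V$ be a non-empty subset, with the induced metric, such that $d_{\mathrm{H}}(X,V)<\infty$. If $V$ satisfies the intersection property, then $$d_{\mathrm{GH}}(X,V)\ \ge\ \frac{1}{2J}\,d_{\mathrm{H}}(X,V).$$
   Context: For non-empty subsets $A,A'$ of a metric space $Z$ with distance $|xy|$ between points $x,y$, write $|xA|=\inf_{a\in A}|xa|$. The Hausdorff distance is $d_{\mathrm{H}}(A,A')=\max\{\sup_{a\in A}|aA'|,\ \sup_{a'\in A'}|a'A|\}\in[0,\infty]$. For non-empty metric spaces $X,Y$, the Gromov--Hausdorff distance $d_{\mathrm{GH}}(X,Y)\in[0,\infty]$ is the infimum of $d_{\mathrm{H}}(X',Y')$ over all metric spaces $Z$ and all subsets $X',Y'\subseteq Z$ isometric to $X$ and $Y$ respectively. Equivalently, $d_{\mathrm{GH}}(X,Y)=\frac12\inf_R\operatorname{dis}R$, where $R$ ranges over all correspondences (subsets $R\subseteq X\times Y$ projecting onto both $X$ and $Y$) and $\operatorname{dis}R=\sup\{||xx'|-|yy'||:(x,y),(x',y')\in R\}$. Jung constant: for a metric space $Z$ with at least two points and a non-empty bounded $X\subseteq Z$, let $R(X)=\inf_{z\in Z}\sup_{x\in X}|zx|$ be the Chebyshev radius. Then $J(Z)=\sup_X \frac{R(X)}{\operatorname{diam}X}$, the supremum being over all bounded $X\subseteq Z$ with at least two points. Intersection property: write $B(x;r)$ and $\bar B(x;r)$ for the open and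 closed balls in $V$ with center $x$ and radius $r$. A finite-dimensional normed space $V$ satisfies the intersection property if for every $\rho>0$ there exists $t>0$ such that for each $t'>t$ and each non-empty finite collection of open balls $B(x_i;r_i)$ with $x_i\in V$ and $0<r_i\le\rho$, the set $(V\setminus\bar B(0;t'))\cap\bigcap_i B(x_i;r_i)$ is either empty or contractible. *)

(* Defs.v *)
From HB Require Import structures.
From mathcomp Require Import all_boot all_order all_algebra.
From mathcomp Require Import all_classical all_reals all_analysis.

Set Implicit Arguments.
Unset Strict Implicit.
Unset Printing Implicit Defensive.

Import Order.TTheory GRing.Theory Num.Theory.
Import numFieldNormedType.Exports.

Local Open Scope classical_set_scope.
Local Open Scope ring_scope.

(* The norm is part of the normedModType structure and is unrelated to the
   coordinates provided by the vectType structure, so it is arbitrary. *)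
#[short(type="normedVectType")]
HB.structure Definition NormedVector (R : numFieldType) :=
  {V of NormedModule R V & Vector R V}.

Section norm_metric.
Context {R : realType} (V : normedVectType R).

Let dist (x y : V) : R := `|x - y|.

Let dist_ge0 x y : 0 <= dist x y.
Proof. exact: normr_ge0. Qed.

Let dist_positivity x y : dist x y = 0 -> x = y.
Proof. by move/normr0_eq0/eqP; rewrite subr_eq0 => /eqP. Qed.

Let ballEdist x d : ball x d = [set y | dist x y < d].
Proof. by rewrite -ball_normE. Qed.

(* normedModType does not inherit from metricType in the library. *)
#[non_forgetful_inheritance]
HB.instance Definition _ := @PseudoMetric_isMetric.Build R
  (NormedVector.sort V) dist dist_ge0 dist_positivity ballEdist.

Lemma mdist_norm (x y : V) : mdist x y = `|x - y|.
Proof. by []. Qed.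

End norm_metric.

Section subset_metric.
Context {R : realType} {M : metricType R} (A : set M).

Let dist (x y : A) : R := mdist (set_val x) (set_val y).

Let dist_ge0 x y : 0 <= dist x y.
Proof. exact: mdist_ge0. Qed.

Let dist_positivity x y : dist x y = 0 -> x = y.
Proof. by move/mdist_positivity; exact: val_inj. Qed.

Let ballEdist (x : A) d : ball x d = [set y | dist x y < d].
Proof. by rewrite -initial_ballE ballEmdist. Qed.

HB.instance Definition _ := @PseudoMetric_isMetric.Build R
  (set_type A) dist dist_ge0 dist_positivity ballEdist.

Lemma mdist_subset (x y : A) : mdist x y = mdist (set_val x) (set_val y).
Proof. by []. Qed.

End subset_metric.

Section metric_notions.
Context {R : realType}.
Local Open Scope ereal_scope.

Definition dist_to_set (M : metricType R) (x : M) (A : set M) : \bar R :=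
  ereal_inf [set (mdist x a)%:E | a in A].

Definition hausdorff_dist (M : metricType R) (A B : set M) : \bar R :=
  maxe (ereal_sup [set dist_to_set a B | a in A])
       (ereal_sup [set dist_to_set b A | b in B]).

Definition isometric (M N : metricType R) : Prop :=
  exists2 f : M -> N,
    bijective f & forall x y : M, mdist (f x) (f y) = mdist x y.

Definition gromov_hausdorff_dist (M N : metricType R) : \bar R :=
  ereal_inf [set e | exists (Z : metricType R) (M' N' : set Z),
    [/\ isometric M M', isometric N N' & e = hausdorff_dist M' N']].

Definition chebyshev_radius (M : metricType R) (A : set M) : \bar R :=
  ereal_inf (range (fun z : M => ereal_sup [set (mdist z x)%:E | x in A])).

Definition diameter (M : metricType R) (A : set M) : \bar R :=
  ereal_sup [set (mdist p.1 p.2)%:E | p in A `*` A].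

(* Every quotient below is real: the diameter of a bounded set with two
   distinct points lies in ]0, +oo[. *)
Definition jung_constant (M : metricType R) : \bar R :=
  ereal_sup [set chebyshev_radius A / diameter A | A in
    [set A : set M | diameter A < +oo /\
                     exists x y, [/\ A x, A y & x != y]]].

End metric_notions.

(* Contractibility of A for the subspace topology; the empty set is not
   contractible. The homotopy is only constrained on A x [0, 1]. *)
Definition contractible_set {R : realType} (T : topologicalType)
    (A : set T) : Prop :=
  exists (c : T) (H : T * R -> T),
    [/\ A c,
        {within A `*` `[0, 1]%classic, continuous H},
        forall x t, A x -> t \in `[0, 1] -> A (H (x, t)),
        forall x, A x -> H (x, 0) = x &
        forall x, A x -> H (x, 1) = c].

Definition intersection_property {R : realType} (V : normedVectType R) : Prop :=
  forall rho : R, 0 < rho ->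
  exists2 t : R, 0 < t &
  forall t' : R, t < t' ->
  forall (n : nat) (x : 'I_n.+1 -> V) (r : 'I_n.+1 -> R),
    (forall i, 0 < r i <= rho) ->
    let S := ~` closed_ball_ Num.norm 0 t' `&`
             \bigcap_(i in [set: 'I_n.+1]) ball (x i) (r i) in
    S = set0 \/ contractible_set (R := R) S.

(* Main.v *)
Require Import Defs.
From HB Require Import structures.
From mathcomp Require Import all_boot all_order all_algebra finmap.
From mathcomp Require Import all_classical all_reals all_analysis.
From mathcomp Require Import zify lra ring.

Set Implicit Arguments.
Unset Strict Implicit.
Unset Printing Implicit Defensive.

Import Order.TTheory GRing.Theory Num.Theory.
Import numFieldNormedType.Exports.

(** Suppose that X and V are at Gromov-Hausdorff distance less than [eta], where
[2 * eta * J < d] and d is the Hausdorff distance. Then there are maps f from V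
to X and g from X to V that change distances by at most [2 * eta] and are
inverse to each other up to [2 * eta] ([gromov_hausdorff_lt_maps]). Composed
with a map that sends each point of V to a point of X at bounded distance, f and
g give a map from V to X at bounded distance from the identity of V. Were it
continuous, it would take every value, and X would be all of V.

The maps are not continuous, but they have small oscillation, and a
discontinuous map can be replaced by a continuous one ([nerve_map]): send the
simplices of the nerve of a fine cover to centres of the images of their
vertices, and interpolate along the barycentric subdivision. For g any centre
will do, as only boundedness matters. For f, after g has been made continuous,
the images of close points have diameter at most [2 * eta + eps], so by
definition of the Jung constant they lie in a ball of a radius r that can be
taken below d ([jung_center]). The result is a continuous map F from V to V, at
bounded distance from the identity, with all values within r of X. As F is onto
([near_identity_surjective]), every point of V is within r of X, which
contradicts [r < d] ([near_image_of_coarse_isometry]).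

The topological input is that continuous maps at bounded distance from the
identity are onto. It comes from a combinatorial lemma of Sperner type
([rainbow_dominated_set]), in the form due to Scarf: the triangulation of a
simplex is replaced by the sets of grid points such that no grid point exceeds
the minima over the set of all the coordinates,
  and a parity count produces such a set with points of all
colours. Such sets are small, which gives a covering lemma on the simplex
([simplex_kkm]), and from there the surjectivity on a large simplex in V. *)

(** * Dominated sets and Sperner's lemma *)

Section dominated_sets.
(* Finite sets here, rather than the classical sets that share their names. *)
Import boot.fintype boot.finset.
Context {U I : finType} (u : I -> U -> nat).

(** Each [u i] ranks the points of [U], the ranks of a family of linear orders.
A dominated set plays the role of a simplex of a triangulation: no point of [U]
is, for every order, strictly better than the worst element of [S] for it. *)
Definition dominated (S : {set U}) : bool :=
  [forall z, exists i, [forall x in S, u i z <= u i x]].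

(** The points better than the worst element of [S] for all orders but [k],
among which the elements that may be added to [S] are to be found. *)
Definition above (S : {set U}) (k : I) : {set U} :=
  [set z | [forall l, (l != k) ==> [exists x in S, u l x < u l z]]].

Definition extensions (S : {set U}) : {set U} :=
  [set z | (z \notin S) && dominated (z |: S)].

Lemma dominatedP (S : {set U}) :
  reflect (forall z, exists i, forall x, x \in S -> u i z <= u i x)
          (dominated S).
Proof.
apply: (iffP forallP) => H z.
  by have /existsP[i /forall_inP] := H z; exists i.
by have [i Hi] := H z; apply/existsP; exists i; apply/forall_inP.
Qed.

Lemma aboveP (S : {set U}) k z :
  reflect (forall l, l != k -> exists2 x, x \in S & u l x < u l z)
          (z \in above S k).
Proof.
rewrite inE; apply: (iffP forallP) => H l.
  by move=> lk; move: (H l); rewrite lk /= => /exists_inP.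
by apply/implyP => lk; apply/exists_inP; exact: H.
Qed.

Lemma dominated_sub (S T : {set U}) :
  S \subset T -> dominated T -> dominated S.
Proof.
move=> /subsetP ST /dominatedP dT; apply/dominatedP => z.
by have [i iz] := dT z; exists i => x /ST; exact: iz.
Qed.

Context (u_inj : forall i, injective (u i)).

(** The local structure of the complex of dominated sets: a facet, that is a
dominated set with one element less than there are orders, is contained in at
most two dominated sets with one more element. Sending an order to the worst
element of [S] maps the orders onto [S], so exactly two orders [i], [j] share
their worst element. A new point of an enlarged dominated set must be the worst
one for [i] or for [j]. If it is so for [k], it belongs to [above S k], and
among the elements of [above S k] only the best one for [k] leaves none that
prevents the enlarged set from being dominated. *)
Lemma card_extensions (S : {set U}) :
  S != set0 -> dominated S -> #|S|.+1 = #|I| ->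
  exists i j, [/\ i != j,
    forall x, x \in S -> (forall y, y \in S -> u i x <= u i y) <->
                         (forall y, y \in S -> u j x <= u j y) &
    #|extensions S| = (above S i != set0) + (above S j != set0)].
Proof.
move=> /set0Pn[x0 x0S] /dominatedP dS cS.
(* [m i] is the worst element of [S] for the order [i]. *)
pose m i := [arg min_(x < x0 in S) u i x].
have mS i : m i \in S by rewrite /m; case: arg_minnP.
have mle i x : x \in S -> u i (m i) <= u i x.
  by rewrite /m; case: arg_minnP => // y _ ymin /ymin.
have mE i x : x \in S -> (forall y, y \in S -> u i x <= u i y) -> x = m i.
  move=> xS xmin; apply: (@u_inj i); apply/eqP; rewrite eqn_leq.
  by rewrite mle // xmin.
have m_onto x : x \in S -> exists i, x = m i.
  by move=> xS; have [i xmin] := dS x; exists i; exact: mE.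
have imS (A : {set I}) : m @: A \subset S.
  by apply/subsetP => _ /imsetP[i _ ->].
have /injectivePn[i [j ij mij]] : ~~ injectiveb m.
  apply/negP => /injectiveP m_inj.
  have := subset_leq_card (imS setT).
  by rewrite card_imset // cardsT -cS ltnn.
have inj_off k k' : k != k' -> m k = m k' -> {in [set~ k] &, injective m}.
  move=> kk' mkk'; apply/imset_injP; rewrite cardsC1 -cS /=; apply/eqP.
  apply/eq_card => x; apply/idP/idP; first exact/subsetP.
  move=> /m_onto[l ->]; have [->|lk] := eqVneq l k.
    by rewrite mkk'; apply: imset_f; rewrite !inE eq_sym.
  by apply: imset_f; rewrite !inE.
have inji := inj_off _ _ ij mij.
have injj : {in [set~ j] &, injective m} by apply: (inj_off j i);
  rewrite 1?eq_sym.
have above_notin k : (k == i) || (k == j) -> forall z, z \in above S k ->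
  z \notin S.
  move=> kij z /aboveP za; apply/negP => /m_onto[l0 zl0].
  have [l lk zl] : exists2 l, l != k & z = m l.
    have [lk|] := eqVneq l0 k; last by exists l0.
    case/orP: kij => /eqP kE; subst.
      by exists j; rewrite 1?eq_sym // mij.
    by exists i; rewrite // -mij.
  have [x xS] := za l lk.
  by rewrite zl ltnNge mle.
have aboveE k z : z \in above S k -> forall l, l != k -> u l (m l) < u l z.
  by move=> /aboveP za l /za[x xS]; apply: leq_ltn_trans; exact: mle.
have disj z : z \in above S i -> z \in above S j -> False.
  move=> /aboveE zi /aboveE zj; have [l lz] := dS z.
  have := lz _ (mS l); rewrite leqNgt; have [lE|/zi -> //] := eqVneq l i.
  by rewrite zj // lE.
have extP z : z \in extensions S -> exists2 k, (k == i) || (k == j) &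
    z \in above S k /\ forall w, w \in above S k -> u k w <= u k z.
  rewrite inE => /andP[zS /dominatedP dz].
  have [k kz] := dz z.
  have kz' x : x \in S -> u k z < u k x.
    move=> xS; rewrite ltn_neqAle kz ?inE ?xS ?orbT // andbT.
    by apply: contra zS => /eqP/u_inj ->.
  have back x : x \in S -> exists2 l, l != k & x = m l /\ u l x < u l z.
    move=> xS; have [l lx] := dz x; exists l; last split.
    - apply/eqP => lk; have := lx z; rewrite inE set11 => /(_ isT).
      by rewrite lk leqNgt kz'.
    - by apply: mE => // y yS; apply: lx; rewrite inE yS orbT.
    - rewrite ltn_neqAle lx ?inE ?eqxx // andbT.
      by apply: contra zS => /eqP/u_inj <-.
  have kij : (k == i) || (k == j).
    apply/norP => -[ki kj]; have [l lk [ml _]] := back _ (mS k).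
    have [li|li] := eqVneq l i.
      move: ml; rewrite li => /injj; rewrite !inE => /(_ kj ij) kE.
      by rewrite kE eqxx in ki.
    move: ml => /inji; rewrite !inE => /(_ ki li) kE.
    by rewrite kE eqxx in lk.
  have injk : {in [set~ k] &, injective m}.
    by case/orP: kij => /eqP ->.
  exists k => //; split.
    apply/aboveP => l lk; exists (m l) => //.
    have [l' l'k [ml ul]] := back _ (mS l).
    suff -> : l = l' by rewrite ml in ul.
    by apply: injk => //; rewrite !inE.
  move=> w wa; have [l lw] := dz w.
  have [<-|lk] := eqVneq l k; first by apply: lw; rewrite inE set11.
  have := lw (m l); rewrite inE mS orbT => /(_ isT).
  by rewrite leqNgt (aboveE _ _ wa).
have Pext k z : (k == i) || (k == j) -> z \in above S k ->
    (forall w, w \in above S k -> u k w <= u k z) -> z \in extensions S.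
  move=> kij za zmax; rewrite inE (above_notin _ kij) //=.
  apply/dominatedP => w; have [wa|] := boolP (w \in above S k).
    exists k => x; rewrite inE => /orP[/set1P -> |xS]; first exact: zmax.
    have [l lw] := dS w; have [lk|lk] := eqVneq l k; first by rewrite -lk lw.
    by have := lw _ (mS l); rewrite leqNgt (aboveE _ _ wa).
  rewrite inE negb_forall => /existsP[l]; rewrite negb_imply => /andP[lk].
  rewrite negb_exists => /forallP wl; exists l => x.
  have wl' y : y \in S -> u l w <= u l y.
    by move=> yS; move: (wl y); rewrite yS /= -leqNgt.
  rewrite inE => /orP[/set1P -> |]; last exact: wl'.
  by apply: leq_trans (wl' _ (mS l)) (ltnW _); exact: (aboveE _ _ za).
pose E k := [set z in above S k | [forall w in above S k, u k w <= u k z]].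
have EP k z : reflect (z \in above S k /\
    forall w, w \in above S k -> u k w <= u k z) (z \in E k).
  rewrite [X in reflect _ X]inE; apply: (iffP andP) => -[H1].
    by move=> /forall_inP.
  by move=> H2; split => //; apply/forall_inP.
have extE : extensions S = E i :|: E j.
  apply/setP => z; rewrite [RHS]inE; apply/idP/orP.
    by move=> /extP[k /orP[] /eqP -> /EP]; [left|right].
  by case=> /EP[za zm]; [apply: (Pext i)|apply: (Pext j)];
    rewrite ?eqxx ?orbT.
have disjE : [disjoint E i & E j].
  apply/pred0P => z /=; apply/negbTE/negP => /andP[/EP[zi _] /EP[zj _]].
  exact: disj zi zj.
have cardE k : #|E k| = (above S k != set0).
  have [a0|/set0Pn[z za]] := eqVneq (above S k) set0.
    by apply: eq_card0 => z; rewrite inE a0 inE.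
  have [y ya ymax] := @arg_maxnP _ z (mem (above S k)) (u k) za.
  rewrite (_ : E k = [set y]) ?cards1 //; apply/setP => w.
  rewrite [RHS]inE; apply/EP/eqP => [[wa wmax]|->].
    apply: (@u_inj k); apply/eqP; rewrite eqn_leq wmax // andbT; exact: ymax.
  by split => // v va; exact: ymax.
exists i, j; split => //.
- move=> x xS; split => xm.
    by rewrite (mE i _ xS xm) mij; exact: mle.
  by rewrite (mE j _ xS xm) -mij; exact: mle.
- by rewrite extE -!cardE cardsU (disjoint_setI0 disjE) cards0 subn0.
Qed.


(** The slack points [s i] stand for the facets of the big simplex: [s i] is the
worst point for [i], and it is better than every genuine point for the other
orders. They make the boundary of the complex as simple as possible. *)
Context (s : I -> U) (t0 : U).
Context (s_low : forall i z, u i (s i) <= u i z).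
Context (s_high :
  forall i j z, j != i -> z \notin codom s -> u i z < u i (s j)).
Context (t0_ns : t0 \notin codom s).

Lemma slack_inj : injective s.
Proof.
move=> i j sij; apply/eqP; apply: contraT => ij.
have := s_high (i := i) (j := j) _ t0_ns; rewrite eq_sym => /(_ ij).
by rewrite -sij ltnNge s_low.
Qed.

(** When [k] and [k'] share their worst element in [S], the slack point [s k]
belongs to [above S k]: an order other than [k] for which it is not better than
the worst element of [S] forces [S] to consist of all slack points but one. *)
Lemma above_neq0 (S : {set U}) (k k' : I) :
  S != set0 -> #|S|.+1 = #|I| -> (forall l, S != s @: [set~ l]) ->
  k != k' ->
  (forall x, x \in S -> (forall y, y \in S -> u k x <= u k y) ->
             forall y, y \in S -> u k' x <= u k' y) ->
  above S k != set0.
Proof.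
move=> S0 cS Sns kk' mkk'.
have allslack l : l != k -> (forall x, x \in S -> u l (s k) <= u l x) ->
    S \subset s @: [set~ l].
  move=> lk ml; apply/subsetP => x xS.
  have /codomP[j xj] : x \in codom s.
    apply: contraT => xns.
    have := s_high (i := l) (j := k) _ xns; rewrite eq_sym => /(_ lk).
    by rewrite ltnNge ml.
  rewrite xj imset_f // !inE; apply: contraNneq lk => jl.
  apply/eqP/slack_inj/(@u_inj l)/eqP; rewrite eqn_leq s_low.
  by rewrite -jl -xj jl ml.
have cslack l : #|s @: [set~ l]| = #|S|.
  by rewrite card_imset ?cardsC1 -?cS //; exact: slack_inj.
have [skS|skS] := boolP (s k \in S).
  have Sk' : S \subset s @: [set~ k'].
    apply: allslack; first by rewrite eq_sym.
    by apply: mkk' => // y _; exact: s_low.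
  case/negP: (Sns k'); rewrite eqEcard Sk' /=.
  by rewrite cslack.
apply/set0Pn; exists (s k); apply/aboveP => l lk.
apply/exists_inP; apply: contraT; rewrite negb_exists => /forallP nl.
have Sl : S \subset s @: [set~ l].
  apply: allslack => // x xS.
  by move: (nl x); rewrite xS /= -leqNgt.
case/negP: (Sns l); rewrite eqEcard Sl /=.
by rewrite cslack.
Qed.

Lemma extensions_even (S : {set U}) :
  S != set0 -> dominated S -> #|S|.+1 = #|I| ->
  (forall k, S != s @: [set~ k]) -> ~~ odd #|extensions S|.
Proof.
move=> S0 dS cS Sns.
have [i [j [ij mij ->]]] := card_extensions S0 dS cS.
rewrite (@above_neq0 S i j) // ?(@above_neq0 S j i) // 1?eq_sym //.
  by move=> x xS /(mij x xS).
by move=> x xS /(mij x xS).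
Qed.

Lemma slack_dominated k : dominated (s @: [set~ k]).
Proof.
apply/dominatedP => z; have [/codomP[l ->]|zns] := boolP (z \in codom s).
  by exists l => x _; exact: s_low.
exists k => _ /imsetP[l + ->]; rewrite !inE => lk.
by apply: ltnW; exact: s_high.
Qed.

(** The sets of all slack points but one are the boundary facets of the complex:
the [k]-th one has a single extension, by the genuine point that is best for
[k]. *)
Lemma slack_extensions_odd k :
  1 < #|I| -> odd #|extensions (s @: [set~ k])|.
Proof.
move=> cI; have cs : #|s @: [set~ k]| = #|I|.-1.
  by rewrite card_imset ?cardsC1 //; exact: slack_inj.
have S0 : s @: [set~ k] != set0 by rewrite -card_gt0 cs -ltnS prednK // ltnW.
have cS : #|s @: [set~ k]|.+1 = #|I| by rewrite cs prednK // ltnW.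
have [i [j [ij mij ->]]] := card_extensions S0 (slack_dominated k) cS.
have above_k : above (s @: [set~ k]) k != set0.
  apply/set0Pn; exists t0; apply/aboveP => l lk; exists (s l).
    by rewrite imset_f // !inE.
  rewrite ltn_neqAle s_low andbT; apply/eqP => /u_inj sl.
  by move: t0_ns; rewrite -sl codom_f.
have above_other l : l != k ->
    (forall x, x \in s @: [set~ k] ->
      (forall y, y \in s @: [set~ k] -> u l x <= u l y) ->
      forall y, y \in s @: [set~ k] -> u k x <= u k y) ->
    above (s @: [set~ k]) l = set0.
  move=> lk mlk; have slS : s l \in s @: [set~ k] by rewrite imset_f // !inE.
  have slmin := mlk _ slS (fun y _ => s_low l y).
  apply/setP => z; rewrite [RHS]inE; apply/negbTE/negP => /aboveP za.
  have [_ /imsetP[j' + ->]] := za k ltac:(by rewrite eq_sym).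
  rewrite !inE => j'k kz.
  have [/codomP[z' zE]|zns] := boolP (z \in codom s); last first.
    have := s_high (i := k) (j := l) lk zns.
    rewrite ltnNge => /negP; apply; apply: leq_trans (ltnW kz).
    by apply: slmin; rewrite imset_f // !inE.
  have z'k : z' != k.
    by apply: contraTneq kz => z'k; rewrite zE z'k -leqNgt s_low.
  have [z'l|z'l] := eqVneq z' l.
    move: kz; rewrite zE z'l ltnNge slmin //.
    by rewrite imset_f // !inE.
  have [x _] := za z' z'l.
  by rewrite zE ltnNge s_low.
have [ik|ik] := eqVneq i k.
  subst i; rewrite above_k (above_other j) ?eqxx //; first by rewrite eq_sym.
  by move=> x xS /(mij x xS).
have [jk|jk] := eqVneq j k.
  subst j; rewrite above_k (above_other i) ?eqxx //.
  by move=> x xS /(mij x xS).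
have sS l : l != k -> s l \in s @: [set~ k] by move=> lk;
  rewrite imset_f // !inE.
have /(_ _ (sS _ jk)) := (mij _ (sS _ ik)).1 (fun y _ => s_low i y).
move=> sji; case/eqP: ij; apply/slack_inj/(@u_inj j)/eqP.
by rewrite eqn_leq s_low sji.
Qed.

(** Sperner's lemma. Fix a colour [i0] and call door a facet that carries all
colours but [i0], each once. Only one boundary facet is a door, so that pairs of
a door and a dominated set extending it are odd in number, by
[card_extensions]. A full-dimensional dominated set without all the colours has
zero or two doors. *)
Lemma rainbow_dominated_set (c : U -> I) :
  (forall i, c (s i) = i) -> 1 < #|I| ->
  exists S : {set U}, [/\ dominated S, #|S| = #|I| & c @: S = setT].
Proof.
move=> cs cI; have /card_gt0P[i0 _] := ltnW cI.
pose doors := [set S : {set U} |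
  [&& dominated S, #|S|.+1 == #|I| & c @: S == [set~ i0]]].
pose cells := [set S : {set U} | dominated S && (#|S| == #|I|)].
have [/existsP[S /and3P[dS /eqP cS /eqP imS]]|] :=
  boolP [exists S : {set U}, [&& dominated S, #|S| == #|I| & c @: S == setT]].
  by exists S.
rewrite negb_exists => /forallP nofull; exfalso.
have odd_sum (T : finType) (A : {set T}) (f : T -> nat) :
    odd (\sum_(x in A) f x) = odd #|[set x in A | odd (f x)]|.
  rewrite -sum1_card big_mkcond [in RHS]big_mkcond /=.
  elim/big_rec2: _ => // x m n _; rewrite !inE.
  by case: (x \in A) => //=; rewrite !oddD => ->; case: (odd (f x)).
(* Double counting of the pairs of a door and an extension of it. *)
have dc : \sum_(S in doors) #|extensions S| =
    \sum_(T in cells) #|[set z in T | T :\ z \in doors]|.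
  pose P := [set p : {set U} * U | (p.1 \in doors) && (p.2 \in extensions p.1)].
  pose Q := [set p : {set U} * U | (p.1 \in cells) &&
     (p.2 \in [set z in p.1 | p.1 :\ z \in doors])].
  have cardpair (A : {set {set U}}) (B : {set U} -> {set U}) :
     \sum_(S in A) #|B S| = #|[set p | (p.1 \in A) && (p.2 \in B p.1)]|.
    rewrite -sum1_card (eq_bigr (fun S => \sum_(z in B S) 1)); last first.
      by move=> S _; rewrite sum1_card.
    by rewrite pair_big_dep /=; apply: eq_bigl => p; rewrite inE.
  rewrite !cardpair -/P -/Q.
  pose g p : {set U} * U := (p.2 |: p.1, p.2).
  have g_inj : {in P &, injective g}.
    move=> [S z] [T w]; rewrite !inE /= =>
      /andP[_ /andP[zS _]] /andP[_ /andP[wT _]].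
    by move=> [ST zw]; subst w; congr (_, _); rewrite -(setU1K zS) ST setU1K.
  rewrite -(card_in_imset g_inj); apply: eq_card => -[T w].
  apply/imsetP/idP => [[[S z]]|].
    rewrite !inE /= => /andP[/and3P[dS cS imS] /andP[zS dzS]] [-> ->].
    by rewrite dzS cardsU1 zS add1n cS setU11 setU1K // dS cS.
  rewrite inE /= => /andP[+ /setIdP[wT]]; rewrite !inE /= => /andP[dT cT] H.
  exists (T :\ w, w); last by rewrite /g /= setD1K.
  by rewrite !inE /= H eqxx /= setD1K.
(* Removing either of the two points of the same colour gives a door. *)
have evens T : T \in cells -> ~~ odd #|[set z in T | T :\ z \in doors]|.
  rewrite inE => /andP[dT cT].
  have imT : c @: T != setT by move: (nofull T); rewrite dT cT.
  have [->|/set0Pn[z0]] := eqVneq [set z in T | T :\ z \in doors] set0.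
    by rewrite cards0.
  rewrite inE => /andP[z0T]; rewrite inE => /and3P[_ cTz0 /eqP imTz0].
  have c_inj : {in T :\ z0 &, injective c}.
    apply/imset_injP; rewrite imTz0 cardsC1.
    by rewrite -(eqP cTz0).
  have cz0 : c z0 != i0.
    apply: contraNneq imT => cz0; rewrite -(setD1K z0T) imsetU1 imTz0 cz0.
    by apply/eqP/setP => i; rewrite !inE orbN.
  have [z1 z1T cz1] : exists2 z1, z1 \in T :\ z0 & c z0 = c z1.
    by apply/imsetP; rewrite imTz0 !inE.
  have /setD1P[z10 z1T'] := z1T.
  rewrite (_ : [set z in T | _] = [set z0; z1]); last first.
    apply/setP => z; rewrite !inE; apply/idP/idP.
      case/andP => zT /and3P[_ _ /eqP imz]; apply: contraT => /norP[zz0 zz1].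
      have : c z \in c @: (T :\ z).
        rewrite imz !inE; apply/negP => /eqP cz.
        have : c z \in c @: (T :\ z0) by rewrite imset_f // !inE zz0.
        by rewrite imTz0 !inE cz eqxx.
      case/imsetP => w /setD1P[wz wT] czw.
      have [wz0|wz0] := eqVneq w z0.
        have : z = z1 
          by apply: c_inj => //; [rewrite !inE zz0|rewrite czw wz0].
        by move=> zE; rewrite zE eqxx in zz1.
      have : z = w by apply: c_inj => //; rewrite !inE ?zz0 ?wz0.
      by move=> zE; rewrite zE eqxx in wz.
    have T1 : c @: (T :\ z1) = [set~ i0].
      rewrite -imTz0; apply/setP => i; apply/imsetP/imsetP => -[w].
        move=> /setD1P[wz1 wT] ->; have [->|wz0] := eqVneq w z0.
          by exists z1.
        by exists w; rewrite // !inE wz0.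
      move=> /setD1P[wz0 wT] ->; have [->|wz1] := eqVneq w z1.
        by exists z0; rewrite // !inE eq_sym z10.
      by exists w; rewrite // !inE wz1.
    case/orP => /eqP ->.
      by rewrite z0T cTz0 imTz0 eqxx (dominated_sub (subD1set _ _) dT).
    rewrite z1T' T1 eqxx (dominated_sub (subD1set _ _) dT) /= andbT.
    by rewrite -(eqP cT) (cardsD1 z1 T) z1T' add1n.
  by rewrite cards2 eq_sym z10.
have : ~~ odd (\sum_(T in cells) #|[set z in T | T :\ z \in doors]|).
  rewrite odd_sum (_ : [set x in cells | _] = set0) ?cards0 //.
  apply/setP => T; rewrite [RHS]inE; apply/negbTE/negP => /setIdP[Tc].
  by apply/negP; exact: evens.
rewrite -dc odd_sum (_ : [set x in doors | _] = [set s @: [set~ i0]]) ?cards1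
  //.
have im_slack k : c @: (s @: [set~ k]) = [set~ k].
  by rewrite -imset_comp (eq_imset _ (fun i => cs i)) imset_id.
apply/setP => S; rewrite [RHS]inE; apply/idP/eqP => [/setIdP[]|->].
  rewrite inE => /and3P[dS /eqP cS /eqP imS] oddS.
  have S0 : S != set0 by rewrite -card_gt0 -ltnS cS.
  have [/existsP[k /eqP SE]|] := boolP [exists k, S == s @: [set~ k]].
    move: imS; rewrite SE im_slack => /(congr1 (@setC _)); rewrite !setCK.
    by move=> /set1_inj ->.
  rewrite negb_exists => /forallP Sns.
  by move: oddS; rewrite (negbTE (extensions_even S0 dS cS Sns)).
apply/setIdP; split; last exact: slack_extensions_odd.
rewrite inE slack_dominated im_slack eqxx andbT /=.
by rewrite card_imset ?cardsC1 ?prednK // ?(ltnW cI) //; exact: slack_inj.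
Qed.

End dominated_sets.

Section grid.
(* Finite sets here, rather than the classical sets that share their names. *)
Import boot.fintype boot.finset.
Context (m N : nat).

(** The points of the standard simplex whose barycentric coordinates are
multiples of [1 / N], with all coordinates multiplied by [N]. *)
Definition grid_point := {f : {ffun 'I_m -> 'I_N.+1} | \sum_i f i == N :> nat}.
Definition grid_coord (x : grid_point) (i : 'I_m) : nat := val x i.

Lemma grid_sum (x : grid_point) : \sum_i grid_coord x i = N.
Proof. by apply/eqP; exact: (valP x). Qed.

Lemma mk_grid (f : 'I_m -> nat) : \sum_i f i = N ->
  exists x : grid_point, forall i, grid_coord x i = f i.
Proof.
move=> fN; have fle i : f i < N.+1 by rewrite ltnS -fN (bigD1 i) //= leq_addr.
pose g := [ffun i => Ordinal (fle i)].
have gN : \sum_i g i == N :> nat.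
  by apply/eqP; rewrite -[RHS]fN; apply: eq_bigr => i _; rewrite ffunE.
by exists (exist _ g gN) => i; rewrite /grid_coord /= ffunE.
Qed.

Definition grid_index (x : grid_point) : nat := enum_rank x.

Lemma grid_index_lt x : grid_index x < #|{: grid_point}|.
Proof. exact: ltn_ord. Qed.

(** The [i]-th coordinate, ties being broken by the enumeration of the grid, and
extended to slack points [inr j]. *)
Definition grid_rank (i : 'I_m) (z : grid_point + 'I_m) : nat :=
  match z with
  | inl x => (grid_coord x i * #|{: grid_point}| + grid_index x).+1
  | inr j => if j == i then 0 else (N.+1 * #|{: grid_point}| + j).+1
  end.

Lemma grid_rank_bound i (x : grid_point) :
  grid_coord x i * #|{: grid_point}| + grid_index x < N.+1 * #|{: grid_point}|.
Proof.
have : grid_coord x i <= N by rewrite -ltnS ltn_ord.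
have := grid_index_lt x; move: (grid_coord x i) (grid_index x) #|_| => a b c;
  nia.
Qed.

Lemma grid_rank_le i (x y : grid_point) :
  grid_rank i (inl x) <= grid_rank i (inl y) ->
    grid_coord x i <= grid_coord y i.
Proof.
rewrite /= ltnS; have := grid_index_lt x; have := grid_index_lt y.
move: (grid_coord x i) (grid_coord y i).
move: (grid_index x) (grid_index y) #|_| => a b c d e; nia.
Qed.

Lemma grid_rank_inj i : injective (grid_rank i).
Proof.
move=> [x|j] [y|k] //=.
- move=> [E]; congr inl.
  suff : grid_index x = grid_index y by move=> /val_inj/enum_rank_inj.
  have := congr1 (modn^~ #|{: grid_point}|) E.
  by rewrite /= !modnMDl !modn_small ?grid_index_lt.
- by case: eqP => // _ [E]; have := grid_rank_bound i x;
  rewrite E ltnNge leq_addr.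
- by case: eqP => // _ [E]; have := grid_rank_bound i y;
  rewrite -E ltnNge leq_addr.
- case: eqP => [->|_]; case: eqP => [->|_] //.
  by move=> [E]; congr inr; apply: val_inj => /=; lia.
Qed.

(** In the grid a dominated set is small: with [a i] the least [i]-th coordinate
in the set, taken to be 0 if the [i]-th slack point belongs to it, the [a i] sum
up to more than [N - m], otherwise raising all of them by one would give a grid
point better than the worst elements of the set.
  As the coordinates of a grid point add up to [N], they
exceed the [a i] by at most [m]. A colour that is missing among the grid points
is that of a slack point, and then the matching coordinate is small. *)
Lemma grid_sperner (c : grid_point -> 'I_m) : 1 < m ->
  exists x : grid_point, forall i,
    (exists y, c y = i /\ forall k, grid_coord x k <= grid_coord y k + m /\
                                    grid_coord y k <= grid_coord x k + m)
    \/ grid_coord x i <= m.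
Proof.
move=> m1; pose i0 := Ordinal (ltnW m1).
have [t0 _] : exists x : grid_point, True.
  have [|x _] := @mk_grid (fun i => if i == i0 then N else 0); last by exists x.
  by rewrite -big_mkcond big_pred1_eq.
pose s := @inr grid_point 'I_m.
pose cc (z : grid_point + 'I_m) := match z with inl x => c x | inr i => i end.
have ns x : inl x \notin codom s by apply/negP => /codomP[].
have s_low i z : grid_rank i (s i) <= grid_rank i z by rewrite /= eqxx.
have s_high i j z : j != i -> z \notin codom s ->
  grid_rank i z < grid_rank i (s j).
  case: z => [x|k]; last by rewrite codom_f.
  move=> /negbTE /= -> _; rewrite ltnS;
    exact: leq_trans (grid_rank_bound i x) (leq_addr _ _).
have [S [/dominatedP dS cS imS]] :=
  rainbow_dominated_set grid_rank_inj s_low s_high (ns t0) (c :=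
    cc) (fun _ => erefl)
            ltac:(by rewrite card_ord).
rewrite card_ord in cS.
have [x0 x0S] : exists x, inl x \in S.
  have [i iz] := dS (inl t0).
  have : s i \notin S by apply/negP => /iz; rewrite /= eqxx.
  move=> siS; have : i \in cc @: S by rewrite imS.
  by case/imsetP => -[x xS _|j jS /= ij]; [exists x|rewrite ij jS in siS].
pose a i := if s i \in S then 0 else grid_coord [arg min_(x < x0 | inl x \in S)
  grid_coord x i] i.
have a_le x i : inl x \in S -> a i <= grid_coord x i.
  rewrite /a; case: ifP => // _; case: arg_minnP => // y _ ymin; exact: ymin.
have sum_a : N < \sum_i a i + m.
  rewrite ltnNge; apply/negP => aN.
  have aN' : \sum_i (if s i \in S then 0 else (a i).+1) <= N.
    apply: leq_trans aN; have -> : \sum_i a i + m = \sum_i (a i).+1.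
      under [RHS]eq_bigr do rewrite -addn1.
      by rewrite big_split /= sum1_card card_ord.
    by apply: leq_sum => i _; case: ifP.
  set b := fun i => if s i \in S then 0 else (a i).+1 in aN'.
  have [|y yE] := @mk_grid (fun i =>
    b i + if i == i0 then N - \sum_i b i else 0).
    rewrite big_split /= [X in _ + X]( _ : _ = N - \sum_i b i) ?subnKC //.
    by rewrite -big_mkcond big_pred1_eq.
  have [i iy] := dS (inl y).
  have siS : s i \notin S by apply/negP => /iy; rewrite /= eqxx.
  have : b i <= a i.
    rewrite /a (negbTE siS); case: arg_minnP => // x xS _.
    have := grid_rank_le (iy _ xS); rewrite yE; lia.
  by rewrite /b (negbTE siS) ltnn.
have x_le x i : inl x \in S -> grid_coord x i <= a i + m.
  move=> xS; have := grid_sum x; rewrite (bigD1 i) //=.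
  have : \sum_(j | j != i) a j <= \sum_(j | j != i) grid_coord x j.
    by apply: leq_sum => j _; exact: a_le.
  move: sum_a; rewrite (bigD1 i) //=; lia.
exists x0 => i; have : i \in cc @: S by rewrite imS.
case/imsetP => -[y yS /= ->|j jS /= ->]; [left|right].
  exists y; split => // k.
  have := x_le _ k x0S; have := x_le _ k yS.
  have := a_le _ k x0S; have := a_le _ k yS; lia.
by have := x_le _ j x0S; rewrite /a /s jS.
Qed.

End grid.

(** * Coverings of the simplex *)

Local Open Scope classical_set_scope.
Local Open Scope ring_scope.

Section uniformity.
Context {R : realType} {T : pseudoMetricType R}.

(** The Lebesgue number principle: the radii that work near each point of a
finite subcover have a positive minimum. *)
Lemma compact_uniform_radius (K : set T) (P : T -> R -> Prop) :
  compact K ->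
  (forall x e e', P x e -> e' <= e -> P x e') ->
  (forall x, K x -> exists2 e, 0 < e & forall y, ball x e y -> P y e) ->
  exists2 e, 0 < e & forall x, K x -> P x e.
Proof.
move=> /compact_near_coveringP cK Pmono Ploc.
have := cK R (0 : R)^'+ (fun e x => P x e) _.
case.
  move=> x /Ploc[e e0 He].
  exists (ball x e, [set e' | e' <= e]) => /=; last first.
    by move=> [y e'] /= [/He Py] le_e'; exact: Pmono Py le_e'.
  split; first exact: nbhsx_ballx.
  near=> e'; near: e'; exact: nbhs_right_le.
move=> e /= e0 He; exists (e / 2); first by rewrite divr_gt0.
move=> x Kx; apply: He => //=; last by rewrite divr_gt0.
by rewrite sub0r normrN gtr0_norm ?divr_gt0 // ltr_pdivrMr // ltr_pMr // ltr1n.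
Unshelve. all: by end_near. Qed.

End uniformity.

Section simplex.
Context {R : realType} (m : nat).
Implicit Types x y : 'rV[R]_m.

Definition simplex : set 'rV[R]_m :=
  [set x | (forall i, 0 <= x ord0 i) /\ \sum_i x ord0 i = 1].

Lemma simplex_le1 x i : simplex x -> x ord0 i <= 1.
Proof.
move=> [x0 <-]; rewrite (bigD1 i) //= lerDl; exact: sumr_ge0.
Qed.

Lemma simplex_compact : compact simplex.
Proof.
apply: bounded_closed_compact.
  exists 1; split => // M M1 x sx /=.
  rewrite [leLHS]/Num.norm /= mx_normrE; apply/bigmax_leP;
    split => [|[i j] _ /=].
    by rewrite ltW // (lt_trans _ M1).
  rewrite ord1 ger0_norm; last by case: sx.
  by rewrite (le_trans (simplex_le1 j sx)) ?ltW.
rewrite (_ : simplex = \bigcap_i [set x | 0 <= x ord0 i] `&`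
                       [set x | \sum_i x ord0 i = 1]); last first.
  by apply/seteqP; split => x [x0 x1]; split => // i; [move=> _;
    exact: x0|exact: (x0 i I)].
apply: closedI.
  apply: closed_bigI => i _.
  by apply: (@closed_comp _ _ (fun x => x ord0 i) [set y | 0 <= y]);
    [move=> x _; exact: coord_continuous | exact: closed_ge].
apply: (@closed_comp _ _ (fun x => \sum_i x ord0 i) [set y | y = 1]).
  have sumc : continuous (fun x : 'rV[R]_m => \sum_i x ord0 i).
    apply: continuous_big => [|i _]; first exact: add_continuous.
    exact: coord_continuous.
  by move=> x _; exact: sumc.
exact: closed_eq.
Qed.

End simplex.

Section simplex_kkm.
Context {R : realType} (m : nat).
Implicit Types x y : 'rV[R]_m.

(** The [B i] come arbitrarily close to having a common point: colour a fine grid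
by the [B i]. Where [grid_sperner] gives a small [i]-th coordinate
instead of a point of colour [i], adding that coordinate to another one gives a
close point of the [i]-th facet. *)
Lemma simplex_sperner (B : 'I_m -> set 'rV[R]_m) (e : R) : (1 < m)%N ->
  (forall x, simplex x -> exists i, B i x) ->
  (forall i x, simplex x -> x ord0 i = 0 -> B i x) ->
  0 < e ->
  exists2 x, simplex x & forall i, exists y, [/\ simplex y, B i y & ball x e y].
Proof.
move=> m1 Bcov Bface e0.
pose N := (Num.truncn (m%:R / e)).+1.
have N0 : 0 < N%:R :> R by rewrite ltr0n.
have Ne : m%:R / N%:R < e.
  rewrite ltr_pdivrMr // mulrC -ltr_pdivrMr //; exact: truncnS_gt.
pose pt (z : grid_point m N) : 'rV[R]_m := \row_i ((grid_coord z i)%:R / N%:R).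
have pt_simplex z : simplex (pt z).
  split=> [i|]; first by rewrite mxE divr_ge0.
  under eq_bigr do rewrite mxE.
  by rewrite -mulr_suml -natr_sum grid_sum divff // gt_eqF.
have /choice[c cB] : forall z, exists i, B i (pt z) by move=> z; exact: Bcov.
have [z zc] := grid_sperner c m1.
exists (pt z) => // i; have [[w [cw zw]]|zi] := zc i.
  exists (pt w); split => //; first by rewrite -cw.
  split=> // a k; rewrite ord1 /ball /= !mxE -mulrBl normrM (gtr0_norm (x :=
    N%:R^-1)) ?invr_gt0 //.
  apply: le_lt_trans Ne; rewrite ler_wpM2r ?invr_ge0 ?(ltW N0) //.
  have [h1 h2] := zw k. rewrite ler_norml; apply/andP; split.
    rewrite lerBrDr addrC lerBlDr -natrD ler_nat; exact: h2.
  by rewrite lerBlDr -natrD ler_nat addnC.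
have [j ji] : exists j : 'I_m, j != i.
  have : (0 < #|[set~ i]%SET|)%N by rewrite cardsC1 card_ord -ltnS prednK //
    ltnW.
  by case/card_gt0P => j; rewrite !inE; exists j.
have := pt_simplex z; set x := pt z => sx.
have xi : `|x ord0 i| < e.
  apply: le_lt_trans Ne; rewrite mxE ger0_norm ?divr_ge0 //.
  by rewrite ler_wpM2r ?invr_ge0 ?(ltW N0) // ler_nat.
move: x sx xi => x sx xi.
pose y : 'rV[R]_m := \row_k (if k == i then 0
  else if k == j then x ord0 j + x ord0 i else x ord0 k).
have sy : simplex y.
  have [x0 x1] := sx; split => [k|].
    by rewrite mxE; case: ifP => // _; case: ifP => // _; exact: addr_ge0.
  rewrite -x1 (bigD1 i) //= (bigD1 j) //= [RHS](bigD1 i) //=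
    [in RHS](bigD1 j) //=.
  rewrite !mxE !eqxx (negbTE ji) add0r addrA (addrC (x ord0 i)); congr (_ + _).
  by apply: eq_bigr => k /andP[ki kj]; rewrite !mxE (negbTE ki) (negbTE kj).
exists y; split => //; first by apply: Bface => //; rewrite mxE eqxx.
split=> // a k; rewrite ord1 /ball /= [y _ _]mxE; case: eqP => [->|_].
  by rewrite subr0.
case: eqP => [->|_]; last by rewrite subrr normr0.
by rewrite opprD addrA subrr add0r normrN.
Qed.

(** The limit case of [simplex_sperner], a dual form of the
Knaster-Kuratowski-Mazurkiewicz lemma. Without a common point some [f i] would
be positive on a ball of uniform radius around each point, by compactness. *)
Lemma simplex_kkm (f : 'I_m -> 'rV[R]_m -> R) : (1 < m)%N ->
  (forall i x, simplex x -> {for x, continuous (f i)}) ->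
  (forall x, simplex x -> exists i, f i x <= 0) ->
  (forall i x, simplex x -> x ord0 i = 0 -> f i x <= 0) ->
  exists2 x, simplex x & forall i, f i x <= 0.
Proof.
move=> m1 fc fcov fface; apply: contrapT => nox.
have [] := @compact_uniform_radius R _ _
  (fun x e => exists i, forall y, ball x e y ->
    0 < f i y) (@simplex_compact R m).
- move=> x e e' [i xi] e'e; exists i => y xy; apply: xi.
  exact: le_ball xy.
- move=> x sx; have [i fi] : exists i, 0 < f i x.
    apply: contrapT => nofi; apply: nox; exists x => // i.
    by rewrite leNgt; apply/negP => fi; apply: nofi; exists i.
  have /nbhs_ballP[e /= e0 He] : nbhs x [set y | 0 < f i y].
    exact: (cvgr_gt _ (fc i x sx) _ fi).
  exists (e / 2); first by rewrite divr_gt0.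
  move=> y xy; exists i => z yz; apply: He; by rewrite [e]splitr;
    exact: ball_triangle xy yz.
move=> e e0 He.
have [x sx xi] := simplex_sperner m1 (B :=
  fun i => [set x | f i x <= 0]) fcov fface e0.
have [i Hi] := He x sx; have [y [_ fy /Hi]] := xi i.
by rewrite ltNge fy.
Qed.

End simplex_kkm.

(** * Maps at bounded distance from the identity *)

Section coordinates.
Context {R : realType} (V : normedVectType R).
Let n := \dim {:V}.
Let b : n.-tuple V := vbasis {:V}.

Lemma sumZ_continuous (T : topologicalType) m (g : 'I_m -> T ->
  R) (e : 'I_m -> V) :
  (forall i, continuous (g i)) -> continuous (fun x => \sum_i g i x *: e i).
Proof.
move=> gc; apply: continuous_big => [|i _ x]; first exact: add_continuous.
by apply: cvgZr_tmp; exact: gc.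
Qed.

(** All norms on a finite-dimensional space are equivalent: the norm of [V] has
a positive minimum on the unit sphere of the coordinate space. *)
Lemma coord_bounded : exists2 L : R, 0 <= L &
  forall (i : 'I_n) (v : V), `|coord b i v| <= L * `|v|.
Proof.
pose Psi (x : 'rV[R]_n) : V := \sum_i x ord0 i *: b`_i.
have Psi_cont : continuous Psi.
  by apply: sumZ_continuous => i; exact: coord_continuous.
have bfree : free b by apply: basis_free; exact: vbasisP.
have Psi0 x : Psi x = 0 -> x = 0.
  move=> x0; apply/rowP => i; rewrite mxE.
  by rewrite -(coord_sum_free (fun i => x ord0 i) i bfree) -/(Psi x) x0 linear0.
have [|||e e0 He] := @compact_uniform_radius R _ [set x : 'rV[R]_n | `|x| = 1]
  (fun x e => e <= `|Psi x|).
- apply: bounded_closed_compact.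
    by exists 1; split => // M M1 x /= ->; exact: ltW.
  apply: (@closed_comp _ _ (fun x : 'rV[R]_n => `|x|) [set y | y = 1]).
    by move=> x _; exact: norm_continuous.
  exact: closed_eq.
- by move=> x e e' xe e'e; exact: le_trans xe.
- move=> x /= x1; have Px : 0 < `|Psi x|.
    rewrite normr_gt0; apply/eqP => /Psi0 x0.
    by move: x1; rewrite x0 normr0 => /esym/eqP; rewrite oner_eq0.
  have nc := cvg_norm (FF := nbhs_filter x) (Psi_cont x).
  have Px2 : `|Psi x| / 2 < `|Psi x| by rewrite ltr_pdivrMr // ltr_pMr // ltr1n.
  have /nbhs_ballP[e /= e0 He] : nbhs x [set y | `|Psi x| / 2 < `|Psi y|].
    exact: (cvgr_gt _ nc _ Px2).
  exists (Num.min e (`|Psi x| / 2)); first by rewrite lt_min e0 divr_gt0.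
  move=> y xy; apply: le_trans (ltW (He y _));
    first by rewrite ge_min lexx orbT.
  by apply: le_ball xy; rewrite ge_min lexx.
exists e^-1; first by rewrite invr_ge0 ltW.
move=> i v; pose x : 'rV[R]_n := \row_i coord b i v.
have Pv : Psi x = v.
  rewrite [RHS](coord_vbasis (memvf v)).
  by apply: eq_bigr => j _; rewrite mxE.
have xle : `|coord b i v| <= `|x|.
  rewrite [leRHS]/Num.norm /= mx_normrE; apply/bigmax_geP; right => /=.
  by exists (ord0, i) => //=; rewrite mxE.
apply: le_trans xle _; have [->|x0] := eqVneq x 0.
  by rewrite normr0 mulr_ge0 // invr_ge0 ltW.
have nx : 0 < `|x| by rewrite normr_gt0.
have := He (`|x|^-1 *: x);
  rewrite /= normrZ normfV normr_id mulVf ?gt_eqF // => /(_ erefl).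
have -> : Psi (`|x|^-1 *: x) = `|x|^-1 *: Psi x.
  rewrite /Psi scaler_sumr; apply: eq_bigr => j _.
  by rewrite mxE scalerA.
rewrite Pv normrZ normfV normr_id => H.
by rewrite ler_pdivlMl // mulrC -ler_pdivlMl.
Qed.

(** The compact set, chosen before [F], is a large simplex centred at [p]. The
functionals [l i] are, up to an
affine change, its barycentric coordinates; as they add up to 0, they are all
nonpositive at [F v - p] only if [F v = p].
On the [i]-th facet [l i (v - p)] is so negative that it stays nonpositive when
[v] is replaced by [F v]; hence [simplex_kkm] applies. *)
Lemma near_identity_surjective (C : R) (p : V) :
  (1 <= n)%N -> 0 <= C ->
  exists2 K : set V, compact K & forall F : V -> V,
    (forall v, K v -> {for v, continuous F}) ->
    (forall v, K v -> `|F v - v| <= C) ->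
    exists2 v, K v & F v = p.
Proof.
move=> n0 C0; have [L L0 Lb] := coord_bounded.
have bfree : free b by apply: basis_free; exact: vbasisP.
pose l (i : 'I_n.+1) (v : V) : R :=
  if unlift ord0 i is Some j then coord b j v else - \sum_j coord b j v.
have lD i : {morph l i : v w / v - w}.
  move=> v w; rewrite /l; case: unlift => [j|]; first exact: linearB.
  by under eq_bigr do rewrite linearB /=; rewrite sumrB opprD.
have l0 v : l ord0 v = - \sum_j coord b j v by rewrite /l unlift_none.
have l_lift j v : l (lift ord0 j) v = coord b j v by rewrite /l liftK.
have l_sum v : \sum_i l i v = 0.
  rewrite big_ord_recl l0 addrC; apply/eqP; rewrite subr_eq0; apply/eqP.
  by apply: eq_bigr => j _; exact: l_lift.
pose L' := L * n.+1%:R.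
have L'0 : 0 <= L' by rewrite mulr_ge0.
have lb i v : `|l i v| <= L' * `|v|.
  have LL' : n%:R * (L * `|v|) <= L' * `|v| /\ L * `|v| <= L' * `|v|.
    have Lv : 0 <= L * `|v| by rewrite mulr_ge0.
    rewrite /L' -natr1; have : 0 <= n%:R :> R by []; move: (n%:R) => nn nn0;
      nra.
  rewrite /l; case: unlift => [j|]; first exact: le_trans (Lb j v) LL'.2.
  rewrite normrN; apply: le_trans LL'.1.
  apply: le_trans (ler_norm_sum _ _ _) _.
  apply: le_trans (ler_sum _ (fun j _ => Lb j v)) _.
  by rewrite sumr_const card_ord mulr_natl.
have lc i : continuous (fun v => l i (v - p)).
  move=> v; apply/cvgrPdist_le => e e0.
  have e'0 : 0 < e / (L' + 1) by rewrite divr_gt0 // ltr_wpDl.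
  have /cvgrPdist_le/(_ _ e'0) : y @[y --> v] --> v by exact: cvg_id.
  apply: filterS => y; rewrite -lD opprB addrA subrK => H.
  apply: le_trans (lb _ _) _; apply: le_trans (ler_wpM2l L'0 H) _.
  by rewrite mulrCA ger_pMr // ler_pdivrMr ?mul1r ?lerDl // ltr_wpDl.
(* With this size, [l i (v - p) = - (L' * C)] on the [i]-th facet. *)
pose M := n.+1%:R * (L' * C).
pose c : R := n.+1%:R^-1.
pose Phi (x : 'rV[R]_n.+1) : V :=
  p + \sum_(j < n) (M * (x ord0 (lift ord0 j) - c)) *: b`_j.
have Phi_cont : continuous Phi.
  have sc : continuous (fun x : 'rV[R]_n.+1 =>
      \sum_(j < n) (M * (x ord0 (lift ord0 j) - c)) *: b`_j).
    apply: sumZ_continuous => j y.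
    exact: (cvgMl_tmp (cvgB (@coord_continuous _ _ _ ord0 (lift ord0 j) y)
      (cvg_cst c))).
  move=> x; exact: (cvgD (cvg_cst p) (sc x)).
have lPhi i x : simplex x -> l i (Phi x - p) = M * (x ord0 i - c).
  move=> [_ x1]; rewrite /l addrC addKr.
  have cj j : coord b j (\sum_(j < n) (M * (x ord0 (lift ord0 j) - c)) *: b`_j)
    =
      M * (x ord0 (lift ord0 j) - c).
    exact: (coord_sum_free (fun j => M * (x ord0 (lift ord0 j) - c)) j bfree).
  case: unliftP => [j ->|->]; first exact: cj.
  under eq_bigr do rewrite cj.
  rewrite -mulr_sumr sumrB sumr_const card_ord.
  move: x1; rewrite big_ord_recl => /(canRL (addKr _)) ->.
  rewrite -mulrN; congr (M * _).
  have : c *+ n = 1 - c.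
    apply/eqP; rewrite eq_sym subr_eq -mulrSr -[c *+ _]mulr_natr.
    by rewrite mulVf // pnatr_eq0.
  by move=> ->; ring.
exists (Phi @` @simplex R n.+1).
  by apply: continuous_compact;
    [exact: continuous_subspaceT|exact: simplex_compact].
move=> F Fc FC.
have KPhi x : simplex x -> (Phi @` @simplex R n.+1) (Phi x) by move=> sx;
  exists x.
have [||||x sx fx] := @simplex_kkm R n.+1 (fun i x => l i (F (Phi x) - p)).
- by rewrite ltnS.
- move=> i x sx.
  have FPhi : {for x, continuous (F \o Phi)}.
    by apply: continuous_comp; [exact: Phi_cont|exact/Fc/KPhi].
  apply: (@continuous_comp _ _ _ (F \o Phi) (fun v => l i (v - p)) x FPhi).
  exact: lc.
- move=> x sx; apply: contrapT => nof.
  have : 0 < \sum_i l i (F (Phi x) - p).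
    rewrite big_ord_recl; apply: ltr_wpDr.
      by apply: sumr_ge0 => i _; rewrite leNgt; apply/negP => /ltW lf;
        apply: nof; exists (lift ord0 i).
    by rewrite ltNge; apply/negP => lf; apply: nof; exists ord0.
  by rewrite l_sum ltxx.
- move=> i x sx xi.
  have -> : F (Phi x) - p = (Phi x - p) - (Phi x - F (Phi x)).
    by rewrite opprB [RHS]addrC addrA subrK.
  rewrite lD lPhi // xi sub0r lerBlDr add0r.
  have -> : M * - c = - (L' * C).
    by rewrite /M /c mulrN mulrAC divff ?mul1r // pnatr_eq0.
  have := lb i (Phi x - F (Phi x)); rewrite ler_norml => /andP[H _].
  apply: le_trans H; rewrite lerN2 ler_wpM2l // distrC; apply: FC; exact: KPhi.
exists (Phi x); first exact: KPhi.
apply/eqP; rewrite -subr_eq0; apply/eqP.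
set w := F (Phi x) - p in fx *.
have w0 (j : 'I_n) : coord b j w = 0.
  have wj (k : 'I_n) : coord b k w <= 0 by have := fx (lift ord0 k);
    rewrite l_lift.
  have := fx ord0; rewrite l0 oppr_le0 => ws.
  apply/eqP; rewrite eq_le wj /=; apply: le_trans ws _.
  rewrite (bigD1 j) //= gerDl; exact: sumr_le0.
by rewrite (coord_vbasis (memvf w)) big1 // => j _; rewrite w0 scale0r.
Qed.

End coordinates.

(** * Continuous substitutes for discontinuous maps *)

Section chain_weights.
Context {R : realType} {I : finType}.
Implicit Types (a : I -> R) (S T : {set I}).

(** Weights for the barycentric subdivision of the simplex spanned by [I]: they
are continuous in [a], and a set has a positive weight only if it consists of
the indices of the largest values of [a], all of them positive. Thus the sets of
positive weight form a chain. *)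
Definition chain_weight a S : R :=
  \prod_(i in S) (Num.max 0 (a i) * \prod_(j in ~: S) Num.max 0 (a i - a j)).

Lemma chain_weight_ge0 a S : 0 <= chain_weight a S.
Proof.
apply: prodr_ge0 => i _; apply: mulr_ge0; first by rewrite le_max lexx.
by apply: prodr_ge0 => j _; rewrite le_max lexx.
Qed.

Lemma chain_weight_gt0 a S i : 0 < chain_weight a S -> i \in S ->
  0 < a i /\ forall j, j \notin S -> a j < a i.
Proof.
move=> w0 iS; have := gt_eqF w0.
rewrite /chain_weight (bigD1 i) //= mulf_eq0 => /negbT/norP[+ _].
rewrite mulf_eq0 => /norP[ai0 aij]; split.
  by move: ai0; apply: contraNT; rewrite -leNgt => ai; rewrite max_l.
move=> j jS; move: aij; rewrite (bigD1 j) ?inE //= mulf_eq0 => /norP[+ _].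
by apply: contraNT; rewrite -leNgt -subr_le0 => ai; rewrite max_l.
Qed.

Lemma chain_weight_total a S T :
  0 < chain_weight a S -> 0 < chain_weight a T ->
    (S \subset T) || (T \subset S).
Proof.
move=> wS wT; apply: contraT => /norP[/subsetPn[i iS iT] /subsetPn[j jT jS]].
have [_ /(_ j jS) ji] := chain_weight_gt0 wS iS.
have [_ /(_ i iT) ij] := chain_weight_gt0 wT jT.
by have := lt_trans ij ji; rewrite ltxx.
Qed.

Lemma chain_weight_ex a i0 : 0 < a i0 ->
  exists2 S : {set I}, S != finset.set0 & 0 < chain_weight a S.
Proof.
move=> ai0; have [i _ imax] := @arg_maxP _ R I i0 predT a isT.
exists [set j | a i <= a j]%SET; first by apply/set0Pn; exists i; rewrite inE.
apply: prodr_gt0 => j; rewrite inE => ij; apply: mulr_gt0.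
  by rewrite lt_max (lt_le_trans ai0 (le_trans (imax _ isT) ij)) orbT.
apply: prodr_gt0 => k; rewrite !inE -ltNge => ki.
by rewrite lt_max subr_gt0 (lt_le_trans ki ij) orbT.
Qed.

Lemma chain_weight_continuous (T : topologicalType) (a : I -> T -> R) S :
  (forall i, continuous (a i)) -> continuous (fun x => chain_weight (a ^~ x) S).
Proof.
move=> ac; have max0c (f : T -> R) : continuous f ->
  continuous (fun x => Num.max 0 (f x)).
  by move=> fc x; apply: continuous_max; [exact: cvg_cst|exact: fc].
apply: continuous_big => [|i _ x]; first exact: mul_continuous.
apply: cvgM; first exact: max0c.
have : continuous (fun x => \prod_(j in ~: S) Num.max 0 (a i x - a j x)).
  apply: continuous_big => [|j _]; first exact: mul_continuous.
  by apply: max0c => y; apply: cvgB; exact: ac.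
exact.
Qed.

End chain_weights.

Section nerve.
Context {R : realType} {V : normedModType R}.

Lemma compact_net (K : set V) (e : R) : compact K -> 0 < e ->
  exists (m : nat) (x : 'I_m -> V), (forall i, K (x i)) /\
    forall v, K v -> exists i, `|v - x i| < e.
Proof.
rewrite compact_cover => cK e0.
have [|v Kv|D DK Kcov] := cK V K (fun x => ball x e).
- by move=> x _; exact: ball_open.
- by exists v => //; exact: ballxx.
pose s := enum_fset D.
exists (size s), (fun i => s`_i); split=> [i|v /Kcov[x /= xD vx]].
  by have /DK := mem_nth 0 (ltn_ord i); rewrite inE.
have xs : (index x s < size s)%N by rewrite index_mem.
exists (Ordinal xs); rewrite /= nth_index //.
by move: vx; rewrite -ball_normE /= distrC.
Qed.

Lemma weighted_mean_ball (I : finType) (P : pred I) (w : I -> R) (c : I ->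
  V) (a : V) (r : R) :
  (forall i, P i -> 0 <= w i) -> 0 < \sum_(i | P i) w i ->
  (forall i, P i -> 0 < w i -> `|c i - a| <= r) ->
  `|(\sum_(i | P i) w i)^-1 *: (\sum_(i | P i) w i *: c i) - a| <= r.
Proof.
move=> w0 W0 cr; set W := \sum_(i | P i) w i in W0 *.
have -> : W^-1 *: (\sum_(i | P i) w i *: c i) - a =
          W^-1 *: \sum_(i | P i) w i *: (c i - a).
  under [in RHS]eq_bigr do rewrite scalerBr.
  rewrite sumrB -scaler_suml scalerBr scalerA mulVf ?scale1r //.
  by rewrite gt_eqF.
rewrite normrZ gtr0_norm ?invr_gt0 // mulrC ler_pdivrMr //.
apply: le_trans (ler_norm_sum _ _ _) _; rewrite mulr_sumr.
apply: ler_sum => i Pi; rewrite normrZ ger0_norm ?w0 // mulrC.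
have := w0 i Pi; rewrite le_eqVlt => /predU1P[<-|wi]; first by rewrite !mulr0.
by rewrite ler_wpM2r ?w0 //; exact: cr.
Qed.

(** A map [h] of small oscillation has a continuous substitute with values close
to those of [h]. Over a fine net of [K], map the simplices of the nerve, seen as vertices of its barycentric subdivision, to the
centres [c S] of the images of their vertices. The sets [S] that are active at
[v] form a chain; for [i] in the smallest of them, all the active [c S] are
within [r] of [h (x i)], and so is their weighted mean. Interpolating [h] itself
would not do: in a general norm, the convex hull of a set need not stay within
[r] of the set. *)
Lemma nerve_map (K : set V) (rho D r : R) (h : V -> V) :
  compact K -> 0 < rho ->
  (forall v w, K v -> K w -> `|v - w| < rho -> `|h v - h w| <= D) ->
  (forall A : set V, A !=set0 ->
     (forall x y, A x -> A y -> `|x - y| <= D) ->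
     exists c, forall x, A x -> `|c - x| <= r) ->
  exists F : V -> V, (forall v, K v -> {for v, continuous F}) /\
    forall v, K v -> exists w, [/\ K w, `|v - w| < rho & `|F v - h w| <= r].
Proof.
move=> cK rho0 hD center.
have [m [x [Kx xnet]]] := compact_net cK (divr_gt0 rho0 (ltr0n R 2)).
pose a i v := rho / 2 - `|v - x i|.
have ac i : continuous (a i).
  move=> v; apply: cvgB; first exact: cvg_cst.
  by apply: cvg_norm; apply: cvgB; [exact: cvg_id|exact: cvg_cst].
have /choice[c cP] : forall S : {set 'I_m}, exists c, S != finset.set0 ->
    (forall i j, i \in S -> j \in S -> `|h (x i) - h (x j)| <= D) ->
    forall i, i \in S -> `|c - h (x i)| <= r.
  move=> S; have [SD|nSD] := pselect (S != finset.set0 /\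
    forall i j, i \in S -> j \in S -> `|h (x i) - h (x j)| <= D); last first.
    by exists 0 => S0 SD; case: nSD.
  have [||c cr] := center [set h (x i) | i in [set i | i \in S]].
  - by case: SD => /set0Pn[i iS] _; exists (h (x i)), i.
  - by move=> _ _ [i iS <-] [j jS <-]; exact: SD.2.
  - by exists c => _ _ i iS; apply: cr; exists i.
pose w S v := chain_weight (a ^~ v) S.
pose W v := \sum_(S : {set 'I_m} | S != finset.set0) w S v.
have wc S : continuous (w S) by exact: chain_weight_continuous.
have Wc : continuous W by apply: continuous_big => // ; exact: add_continuous.
have W0 v : K v -> 0 < W v.
  move=> /xnet[i vi]; have [|S S0 wS] := @chain_weight_ex R _ (a ^~ v) i.
    by rewrite subr_gt0.
  rewrite /W (bigD1 S) //= ltr_wpDr //.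
  by apply: sumr_ge0 => T _; exact: chain_weight_ge0.
exists (fun v => (W v)^-1 *: \sum_(S : {set 'I_m} | S != finset.set0) w S v *:
  c S).
split=> [v Kv|v Kv].
  apply: cvgZ.
    by apply: cvgV; [rewrite gt_eqF // W0|exact: Wc].
  have : continuous (fun v => \sum_(S : {set 'I_m} | S != finset.set0) w S v *:
    c S).
    apply: continuous_big => [|S _ u]; first exact: add_continuous.
    by apply: cvgZr_tmp; exact: wc.
  exact.
have [S0 S0n wS0] : exists2 S0 : {set 'I_m}, S0 != finset.set0 & 0 < w S0 v.
  by have [i vi] := xnet v Kv; apply: (@chain_weight_ex _ _ _ i);
    rewrite subr_gt0.
pose act (S : {set 'I_m}) := (S != finset.set0) && (0 < w S v).
have actS0 : act S0 by rewrite /act S0n.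
have [S /andP[Sn wS] Smin] := @arg_minnP _ S0 act (fun S => #|S|) actS0.
have Ssub T : act T -> S \subset T.
  move=> aT; have /andP[_ wT] := aT;
    have /orP[//|TS] := chain_weight_total wS wT.
  have /eqP -> : T == S by rewrite eqEcard TS; exact: Smin.
  by [].
have /set0Pn[i iS] := Sn.
have near_i T j : act T -> j \in T -> `|v - x j| < rho / 2.
  by move=> /andP[_ wT] jT; have [+ _] := chain_weight_gt0 wT jT;
    rewrite subr_gt0.
exists (x i); split => //.
  apply: lt_le_trans (near_i S i _ iS) _; first by rewrite /act Sn.
  by rewrite ler_pdivrMr // ler_pMr // ler1n.
apply: weighted_mean_ball => [T _||T Tn wT].
- exact: chain_weight_ge0.
- exact: W0.
have aT : act T by rewrite /act Tn.
apply: cP => //; [|exact: (fintype.subsetP (Ssub T aT))].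
move=> j k jT kT; apply: hD => //.
rewrite [rho]splitr; apply: le_lt_trans (ler_distD v _ _) _.
by apply: ltrD; [rewrite distrC|]; exact: (near_i T).
Qed.

End nerve.

(** * Coarse isometries between a space and a subset *)

Section core.
Context {R : realType} (V : normedVectType R).

(** The maps [f] and [g] are inverse isometries between [V] and [X] up to the
error [delta]. Precomposed with a choice [pi] of close points of [X], the map
[g] has bounded oscillation, so that it has a continuous substitute [G] at
bounded distance, without any control on that distance. As [G] is continuous,
[h := f \o G] has oscillation [delta + eps] at small scale, and [nerve_map]
makes it into a continuous [F] with values within [r] of [X]: only this last
step costs a distance that matters. Since [F] is at bounded distance from the
identity, it is onto. *)
Lemma near_image_of_coarse_isometry (X : set V) (f g : V ->
  V) (delta E eps r : R) :
  (1 <= \dim {:V})%N -> 0 < eps ->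
  (forall v, exists2 x, X x & `|v - x| <= E) ->
  (forall v, X (f v)) ->
  (forall v w, `|f v - f w| <= `|v - w| + delta) ->
  (forall x y, X x -> X y -> `|g x - g y| <= `|x - y| + delta) ->
  (forall x, X x -> `|f (g x) - x| <= delta) ->
  (forall A : set V, A !=set0 ->
     (forall x y, A x -> A y -> `|x - y| <= delta + eps) ->
     exists c, forall x, A x -> `|c - x| <= r) ->
  forall p, exists2 x, X x & `|p - x| <= r.
Proof.
move=> dim0 eps0 XE fX fd gd fg center p.
have /choice[pi piP] : forall v, exists x, X x /\ `|v - x| <= E.
  by move=> v; have [x ? ?] := XE v; exists x.
have piX v := (piP v).1; have pid v := (piP v).2.
(* [C1] bounds the distance from [G] to [g \o pi], and [C] the one from [F] to
   the identity; the compact set [K] has to be chosen before [G] and [F]. *)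
pose C1 := 1 + 2 * E + delta.
pose C := r + (C1 + delta + delta + E + 1) + 1.
have d0 : 0 <= delta by exact: le_trans (normr_ge0 _) (fg _ (piX 0)).
have E0 : 0 <= E by exact: le_trans (normr_ge0 _) (pid 0).
have r0 : 0 <= r.
  have [||c cr] := center [set 0]; first by exists 0.
    by move=> _ _ -> ->; rewrite subrr normr0 addr_ge0 // ltW.
  exact: le_trans (normr_ge0 _) (cr 0 erefl).
have C0 : 0 <= C by rewrite /C /C1; lra.
have [K cK Ksurj] := near_identity_surjective p dim0 C0.
have [||G [Gc Gn]] := @nerve_map R V K 1 C1 C1 (g \o pi) cK ltr01.
- move=> v w _ _ vw /=; apply: le_trans (gd _ _ (piX v) (piX w)) _.
  have := ler_distD v (pi v) (pi w); have := ler_distD w v (pi w).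
  have := pid v; have := pid w; rewrite (distrC (pi v) v) /C1; lra.
- by move=> A [c Ac] Ad; exists c => x Ax; exact: Ad.
pose h v := f (G v).
have hd v : K v -> `|h v - v| <= C1 + delta + delta + E + 1.
  move=> /Gn[w [_ vw Gw]]; rewrite /h; set u := pi w in Gw.
  have := fd (G v) (g u); have := fg u (piX w).
  have := ler_distD (f (g u)) (f (G v)) v; have := ler_distD u (f (g u)) v.
  have := ler_distD w u v; have := pid w; rewrite -/u.
  move: Gw vw; rewrite /= -/u (distrC w u) (distrC w v); lra.
have [||rho rho0 Grho] := @compact_uniform_radius R V K
    (fun v rho => forall w, `|v - w| < rho -> `|G v - G w| <= eps) cK.
- by move=> v e e' ve e'e w vw; apply: ve; exact: lt_le_trans vw e'e.
- move=> v Kv; have e20 : 0 < eps / 2 by rewrite divr_gt0.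
  have /nbhs_ballP[e /= e0 He] : nbhs v [set w | `|G v - G w| <= eps / 2].
    by move/cvgrPdist_le: (Gc v Kv) => /(_ _ e20).
  exists (e / 2); first by rewrite divr_gt0.
  move=> y vy w yw.
  have vw : ball v e w.
    by rewrite [e]splitr; apply: ball_triangle vy _; rewrite -ball_normE.
  have vy' : ball v e y by apply: le_ball vy; lra.
  have := He _ vw; have := He _ vy' => /=.
  have := ler_distD (G v) (G y) (G w); rewrite (distrC (G y) (G v)); lra.
have rho'0 : 0 < Num.min rho 1 by rewrite lt_min rho0 ltr01.
have [|F [Fc Fn]] := @nerve_map R V K (Num.min rho 1) (delta + eps) r h cK
  rho'0 _ center.
  move=> v w Kv Kw; rewrite lt_min => /andP[vw _].
  by have := fd (G v) (G w); have := Grho v Kv w vw; rewrite /h; lra.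
have [v Kv|v Kv Fv] := Ksurj F Fc.
  have [w [Kw + Fw]] := Fn v Kv; rewrite lt_min => /andP[_ vw].
  have := hd w Kw; have := ler_distD (h w) (F v) v; have := ler_distD w (h w) v.
  by rewrite /C (distrC w v); lra.
have [w [_ _ Fw]] := Fn v Kv; exists (h w); first exact: fX.
by rewrite -Fv.
Qed.

End core.

(** * Jung constant and Gromov-Hausdorff distance *)

Section jung.
Context {R : realType} (V : normedVectType R).
Local Open Scope ereal_scope.

Lemma diameter_ge (M : metricType R) (A : set M) x y : A x -> A y ->
  (mdist x y)%:E <= diameter A.
Proof. by move=> Ax Ay; apply: ereal_sup_ubound; exists (x, y). Qed.

Lemma diameter_gt0 (M : metricType R) (A : set M) x y : A x -> A y -> x != y ->
  0 < diameter A.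
Proof.
move=> Ax Ay xy; apply: lt_le_trans (diameter_ge Ax Ay).
rewrite lte_fin lt_neqAle mdist_ge0 andbT; apply: contra xy => /eqP/esym.
by move/mdist_positivity => ->.
Qed.

(** Any point of the set serves as a centre. *)
Lemma chebyshev_radius_le_diameter (M : metricType R) (A : set M) :
  A !=set0 -> chebyshev_radius A <= diameter A.
Proof.
move=> [z Az]; apply: ereal_inf_le;
  exists (ereal_sup [set (mdist z x)%:E | x in A]).
  by exists z.
by apply: ge_ereal_sup => _ [x Ax <-]; exact: diameter_ge.
Qed.

Lemma jung_constant_le1 (M : metricType R) : jung_constant M <= 1.
Proof.
apply: ge_ereal_sup => _ [A [dA [x [y [Ax Ay xy]]]] <-].
have d0 := diameter_gt0 Ax Ay xy.
have := @chebyshev_radius_le_diameter _ A (ex_intro _ x Ax).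
case: (diameter A) d0 dA => [d d0 _|//|//].
have dn0 : (d == 0)%R = false by rewrite gt_eqF // -lte_fin.
by rewrite inver dn0 => cd; rewrite lee_pdivrMr ?mul1e // -lte_fin.
Qed.

(** A pair of points at distance [d] has radius at least [d / 2]. *)
Lemma jung_constant_gt0 : (1 <= \dim {:V})%N -> 0 < jung_constant V.
Proof.
move=> dim0; have [v v0] : exists v : V, v != 0%R.
  exists (vpick {:V}); rewrite vpick0 -dimv_eq0 -lt0n //.
have nv : (0 < `|v|)%R by rewrite normr_gt0.
pose A : set V := [set x | x = 0%R \/ x = v].
have A0 : A 0%R by left.
have Av : A v by right.
have dA : diameter A = `|v|%:E.
  apply/eqP; rewrite eq_le; apply/andP; split; last first.
    by have := diameter_ge A0 Av; rewrite mdist_norm sub0r normrN.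
  apply: ge_ereal_sup => _ [[x y] /= [[->|->] [->|->]] <-];
    by rewrite mdist_norm lee_fin ?subrr ?normr0 ?sub0r ?subr0 ?normrN // ltW.
apply: (@lt_le_trans _ _ (chebyshev_radius A / diameter A)); last first.
  apply: ereal_sup_ubound; exists A => //; split; first by rewrite dA ltry.
  by exists v, 0%R.
rewrite dA inver gt_eqF //; apply: mule_gt0; last by rewrite lte_fin invr_gt0.
apply: (@lt_le_trans _ _ (`|v| / 2)%:E); first by rewrite lte_fin divr_gt0.
apply: le_ereal_inf_tmp => _ [z _ <-].
have [zv|zv] := lerP (`|v| / 2) `|z - 0|%R.
  by apply: (@le_trans _ _ (mdist z 0%R)%:E);
    [rewrite lee_fin|apply: ereal_sup_ubound; exists 0%R].
apply: (@le_trans _ _ (mdist z v)%:E); last by apply: ereal_sup_ubound;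
  exists v.
rewrite lee_fin mdist_norm; have := ler_distD z v 0%R.
by rewrite (distrC v z) subr0; move: zv; rewrite subr0; lra.
Qed.

(** The gap between [j * D] and [r] allows for an infimum over the centres that
is not attained. A set with a single point, to which the Jung constant does not
apply, has that point for centre. *)
Lemma jung_center (j D r : R) : jung_constant V = j%:E -> (0 <= r)%R ->
  (j * D < r)%R ->
  (0 <= j)%R ->
  forall A : set V, A !=set0 -> (forall x y, A x -> A y -> `|x - y| <= D)%R ->
  exists c, forall x, A x -> (`|c - x| <= r)%R.
Proof.
move=> Jj r0 jD j0 A [a Aa] AD.
have [[b Ab ab]|A1] := pselect (exists2 b, A b & b != a); last first.
  exists a => x Ax; have [->|xa] := eqVneq x a; first by rewrite subrr normr0.
  by case: A1; exists x.
have dD : diameter A <= D%:E.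
  by apply: ge_ereal_sup => _ [[x y] /= [Ax Ay] <-];
    rewrite lee_fin mdist_norm; exact: AD.
have d0 : 0 < diameter A := diameter_gt0 Ab Aa ab.
have : chebyshev_radius A / diameter A <= j%:E.
  rewrite -Jj; apply: ereal_sup_ubound; exists A => //; split.
    exact: le_lt_trans dD (ltry _).
  by exists b, a.
have : chebyshev_radius A <= diameter A.
  by apply: chebyshev_radius_le_diameter; exists a.
case dE : (diameter A) d0 dD => [d| |] //; rewrite lte_fin lee_fin => d0 dD _.
rewrite inver gt_eqF // lee_pdivrMr // => Rd.
have : chebyshev_radius A < r%:E.
  apply: le_lt_trans Rd _; rewrite lte_fin; apply: le_lt_trans jD.
  by rewrite ler_wpM2l.
case/ereal_inf_lt => _ [z _ <-] zr; exists z => x Ax.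
rewrite -lee_fin; apply: le_trans (ltW zr).
by apply: ereal_sup_ubound; exists x.
Qed.

End jung.

Section gromov_hausdorff.
Context {R : realType}.
Local Open Scope ereal_scope.

Lemma hausdorff_lt_near (M : metricType R) (A B : set M) (e : \bar R) :
  hausdorff_dist A B < e ->
  (forall a, A a -> exists2 b, B b & (mdist a b)%:E < e) /\
  (forall b, B b -> exists2 a, A a & (mdist b a)%:E < e).
Proof.
rewrite /hausdorff_dist gt_max => /andP[HA HB]; split=> x Ax.
  have : dist_to_set x B < e.
    by apply: le_lt_trans HA; apply: ereal_sup_ubound; exists x.
  by case/ereal_inf_lt => _ [y By <-]; exists y.
have : dist_to_set x A < e.
  by apply: le_lt_trans HB; apply: ereal_sup_ubound; exists x.
by case/ereal_inf_lt => _ [y By <-]; exists y.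
Qed.

(** In a common metric space, send each point to a point of the other set at
distance at most [e]. *)
Lemma gromov_hausdorff_lt_maps (M N : metricType R) (e : R) :
  gromov_hausdorff_dist M N < e%:E ->
  exists (f : N -> M) (g : M -> N), [/\
    forall y y', (mdist (f y) (f y') <= mdist y y' + 2 * e)%R,
    forall x x', (mdist (g x) (g x') <= mdist x x' + 2 * e)%R &
    forall x, (mdist (f (g x)) x <= 2 * e)%R].
Proof.
case/ereal_inf_lt => _ [Z [M' [N' [[phi [phi' phiK phiK'] phid] [psi [psi' psiK
  psiK'] psid] ->]]]].
move=> /hausdorff_lt_near[HM HN].
have /choice[g gP] : forall x, exists y,
  (mdist (set_val (phi x)) (set_val (psi y)) <= e)%R.
  move=> x; have [z zN] := HM _ (set_valP (phi x)); rewrite lte_fin => /ltW xz.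
  by exists (psi' (SigSub (mem_set zN))); rewrite psiK'.
have /choice[f fP] : forall y, exists x,
  (mdist (set_val (psi y)) (set_val (phi x)) <= e)%R.
  move=> y; have [z zM] := HN _ (set_valP (psi y)); rewrite lte_fin => /ltW yz.
  by exists (phi' (SigSub (mem_set zM))); rewrite phiK'.
pose P x := set_val (phi x); pose Q y := set_val (psi y).
have Pd x x' : mdist (P x) (P x') = mdist x x' by rewrite -phid mdist_subset.
have Qd y y' : mdist (Q y) (Q y') = mdist y y' by rewrite -psid mdist_subset.
exists f, g; split=> [y y'|x x'|x].
- rewrite -Pd -Qd; have := metric_triangle (P (f y)) (Q y) (P (f y')).
  have := metric_triangle (Q y) (Q y') (P (f y')).
  by have := fP y; have := fP y';
    rewrite -/(P _) -/(Q _) (metric_sym (P (f y)) (Q y)); lra.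
- rewrite -Pd -Qd; have := metric_triangle (Q (g x)) (P x) (Q (g x')).
  have := metric_triangle (P x) (P x') (Q (g x')).
  by have := gP x; have := gP x';
    rewrite -/(P _) -/(Q _) (metric_sym (Q (g x)) (P x)); lra.
- rewrite -Pd; have := metric_triangle (P (f (g x))) (Q (g x)) (P x).
  have := fP (g x); have := gP x; rewrite -/(P _) -/(Q _).
  by rewrite (metric_sym (P (f (g x))) (Q (g x))) (metric_sym (Q (g x)) (P x));
    lra.
Qed.

End gromov_hausdorff.

(** The bound [d] only provides points of [X] at bounded distance from those of
[V]; the sharp bound is [e]. *)
Lemma hausdorff_le_jung (R : realType) (V : normedVectType R) (X : set V)
    (j e eta d : R) :
  (1 <= \dim {:V})%N -> X !=set0 ->
  (hausdorff_dist X [set: V] < d%:E)%E ->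
  jung_constant V = j%:E -> 0 < j ->
  (gromov_hausdorff_dist X V < eta%:E)%E ->
  j * (2 * eta) < e ->
  (hausdorff_dist X [set: V] <= e%:E)%E.
Proof.
move=> dim0 [x0 Xx0] /hausdorff_lt_near[_ HV] Jj j0.
move=> /gromov_hausdorff_lt_maps[f [g [fd gd fg]]] je.
have eta0 : 0 <= 2 * eta.
  exact: le_trans (mdist_ge0 _ _) (fg (SigSub (mem_set Xx0))).
have e0 : 0 <= e by apply: ltW; apply: le_lt_trans je; rewrite mulr_ge0 // ltW.
pose g' v := if pselect (X v) is left Xv then g (SigSub (mem_set Xv)) else 0.
have g'E (x : X) : g' (set_val x) = g x.
  rewrite /g'; case: pselect => [Xx|]; last by case; exact: set_valP.
  by congr g; exact: val_inj.
(* [eps] is chosen so that [j * (2 * eta + eps)] is halfway between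
   [j * (2 * eta)] and [e]. *)
pose eps := (e - j * (2 * eta)) / (2 * j).
have eps0 : 0 < eps by rewrite divr_gt0 ?subr_gt0 ?mulr_gt0.
have jD : j * (2 * eta + eps) < e.
  rewrite mulrDr /eps.
  have -> : j * ((e - j * (2 * eta)) / (2 * j)) = (e - j * (2 * eta)) / 2.
    by field; rewrite gt_eqF.
  by move: je; lra.
have Xp : forall p : V, exists2 x, X x & `|p - x| <= e.
  apply: (@near_image_of_coarse_isometry R V X (fun v => set_val (f v)) g'
    (2 * eta) d eps e dim0 eps0).
  - by move=> v; have [x Xx] := HV v I; rewrite lte_fin mdist_norm => /ltW;
    exists x.
  - by move=> v; exact: set_valP.
  - by move=> v w; have := fd v w; rewrite mdist_subset !mdist_norm.
  - move=> x y Xx Xy.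
    have := gd (SigSub (mem_set Xx)) (SigSub (mem_set Xy)).
    by rewrite -!g'E mdist_subset !mdist_norm.
  - move=> x Xx; have := fg (SigSub (mem_set Xx)).
    by rewrite -g'E mdist_subset mdist_norm.
  - exact: jung_center Jj e0 jD (ltW j0).
rewrite /hausdorff_dist ge_max; apply/andP; split;
  apply: ge_ereal_sup => _ [p _ <-]; apply: ge_ereal_inf.
  by exists (mdist p p)%:E; [exists p|rewrite mdistxx lee_fin].
have [x Xx px] := Xp p.
by exists (mdist p x)%:E; [exists x|rewrite lee_fin mdist_norm].
Qed.

Theorem theorem6p1 (R : realType) (V : normedVectType R) (X : set V) :
  (1 <= \dim {:V})%N ->
  X !=set0 ->
  (hausdorff_dist X [set: V] < +oo)%E ->
  intersection_property V ->
  (1 / (2%:E * jung_constant V) * hausdorff_dist X [set: V]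
     <= gromov_hausdorff_dist X V)%E.
Proof.
move=> dim0 X0 dy _.
have := jung_constant_gt0 dim0; have := @jung_constant_le1 R V.
case Jj : (jung_constant V) => [j| |] //; rewrite lee_fin lte_fin => _ j0.
have d0 : (0 <= hausdorff_dist X [set: V])%E.
  rewrite /hausdorff_dist le_max; apply/orP; left; have [x Xx] := X0.
  apply: (@le_trans _ _ (dist_to_set x [set: V])).
    by apply: le_ereal_inf_tmp => _ [y _ <-]; rewrite lee_fin mdist_ge0.
  by apply: ereal_sup_ubound; exists x.
case de : (hausdorff_dist X [set: V]) d0 dy => [d| |] // + _;
  rewrite lee_fin => d0.
rewrite -EFinM inver gt_eqF ?mulr_gt0 // mul1e -EFinM leNgt; apply/negP => gh.
have [eta gh_eta eta_d] : exists2 eta : R,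
    (gromov_hausdorff_dist X V < eta%:E)%E & j * (2 * eta) < d.
  have jd a : a < (2 * j)^-1 * d -> j * (2 * a) < d.
    by rewrite mulrC ltr_pdivlMr ?mulr_gt0 // mulrCA mulrA mulrC.
  case: (gromov_hausdorff_dist X V) gh => [a| |] // gh.
    move: gh; rewrite lte_fin => gh; exists ((a + (2 * j)^-1 * d) / 2).
      by rewrite lte_fin; lra.
    by apply: jd; lra.
  exists ((2 * j)^-1 * d - 1); first exact: ltNyr.
  by apply: jd; rewrite ltrBlDr ltrDl.
pose e := (j * (2 * eta) + d) / 2.
have ej : j * (2 * eta) < e by rewrite /e; lra.
have dd1 : (hausdorff_dist X [set: V] < (d + 1)%:E)%E by rewrite de lte_fin
  ltrDl.
have := hausdorff_le_jung dim0 X0 dd1 Jj j0 gh_eta ej.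
by rewrite de lee_fin /e; lra.
Qed.
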